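(* There exists a universal constant $C>0$ (independent of $p$, $n$ and the random vector) such that the following holds. Let $p\ge 1$ and let $X=(X_1,\dots,X_n)$ be a random vector in $\mathbb{R}^n$ with independent $p$-sub-exponential coordinates. Then $$ \big\|\,|X|_p-\||X|_p\|_{L^p}\,\big\|_{\psi_p}\le (2C\sqrt{n})^{1/p} K_p, $$ where $K_p=\max_{1\le i\le n}\|X_i\|_{\psi_p}$.
   Context: For $p>0$, a real random variable $Y$ is called $p$-sub-exponential if there exist constants $c,C'>0$ such that $\mathbb{P}(|Y|\ge t)\le c\exp(-(t/C')^p)$ for all $t\ge 0$; equivalently, $\|Y\|_{\psi_p}<\infty$, where $$\|Y\|_{\psi_p}:=\inf\{K>0:\ \mathbb{E}\exp(|Y/K|^p)\le 2\},\qquad \inf\emptyset=\infty.$$ For $x\in\mathbb{R}^n$ and $p\ge1$, $|x|_p=(\sum_{i=1}^n|x_i|^p)^{1/p}$. For a random variable $Y$, $\|Y\|_{L^p}=(\mathbb{E}|Y|^p)^{1/p}$. Thus $\||X|_p\|_{L^p}=(\sum_{i=1}^n\mathbb{E}|X_i|^p)^{1/p}$ is a deterministic number. *)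

(* Defs.v *)
From mathcomp Require Import all_boot all_order all_algebra.
From mathcomp Require Import all_classical all_reals all_analysis.

Set Implicit Arguments.
Unset Strict Implicit.
Unset Printing Implicit Defensive.

Import Order.TTheory GRing.Theory Num.Theory.
Import numFieldNormedType.Exports.

Local Open Scope classical_set_scope.
Local Open Scope ring_scope.

Definition sub_exponential (d : measure_display) (T : measurableType d)
    (R : realType) (P : probability T R) (p : R) (Y : T -> R) : Prop :=
  exists c C' : R, [/\ 0 < c, 0 < C' &
    forall t : R, 0 <= t ->
      (P [set w | (t <= `|Y w|)%R] <= (c * expR (- ((t / C') `^ p)))%:E)%E].

(* Extended-real valued: the infimum of the empty set is +oo. *)
Definition psi_norm (d : measure_display) (T : measurableType d)
    (R : realType) (P : probability T R) (p : R) (Y : T -> R) : \bar R :=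
  ereal_inf [set K%:E | K in [set K : R |
    0 < K /\ ('E_P[fun w => (expR (`|Y w / K| `^ p))%R] <= 2%:E)%E]].

Definition lp_norm (R : realType) (n : nat) (p : R) (x : 'I_n -> R) : R :=
  (\sum_(i < n) `|x i| `^ p) `^ p^-1.

Definition mutually_independent (d : measure_display) (T : measurableType d)
    (R : realType) (P : probability T R) (n : nat)
    (X : 'I_n -> {RV P >-> R}) : Prop :=
  forall (J : {set 'I_n}) (B : 'I_n -> set R),
    (forall i, measurable (B i)) ->
    P [set w | forall i, i \in J -> B i (X i w)] =
    (\prod_(i in J) P (X i @^-1` B i))%E.

(* Main.v *)
Require Import Defs.
From mathcomp Require Import all_boot all_order all_algebra.
From mathcomp Require Import all_classical all_reals all_analysis.
From mathcomp Require Import measurable_realfun ring lra.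

Import Order.TTheory GRing.Theory Num.Theory.
Import numFieldNormedType.Exports.

Local Open Scope classical_set_scope.
Local Open Scope ring_scope.

(* For [p >= 1], [|a - b|^p <= |a^p - b^p|] on nonnegative reals; hence
   [||X|_p - m|^p <= |sum_i (|X_i|^p - E|X_i|^p)|] with [m] the [L^p] norm of
   [|X|_p], and it suffices to bound the [psi_1] norm of this sum.  Normalize by
   [K > K_p]: [Y_i = |X_i / K|^p >= 0] has [E exp Y_i <= 2], so
   [E exp (l (Y_i - E Y_i)) <= exp (32 e l^2)] for [|l| <= 1/2].  By independence
   the sum [S] of the [Y_i - E Y_i] satisfies [E exp (+- l S) <= 2] for
   [l = 1 / (C sqrt n)], [C = 8 sqrt e], whence [E exp (l |S| / 2) <= 2]. *)

(** * Elementary inequalities for the exponential and for real powers *)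

Section RealInequalities.
Context {R : realType}.
Implicit Types a b p x z l : R.

(** From [secant], exp x - 1 - x <= x (exp x - 1). The right side is at most x^2 exp x for x >= 0 by
    [secant] again, and at most x^2 for x < 0 by the tangent line at 0. *)
Lemma expR_le_quadratic x : expR x <= 1 + x + x ^+ 2 * expR `|x|.
Proof.
(* This is 1 - y <= exp (-y) multiplied by exp y. *)
have secant (y : R) : expR y - 1 <= y * expR y.
  have := expR_ge1Dx (- y); have := expR_gt0 y; have := expRxMexpNx_1 y.
  by set e := expR y; set e' := expR (- y); nra.
have tangent := expR_ge1Dx x.
have [x0|x0] := leP 0 x.
  by rewrite ger0_norm//; have := secant x; nra.
rewrite ltr0_norm//.
have : 1 <= expR (- x) by rewrite -expR0 ler_expR; lra.
by have := secant x; nra.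
Qed.

(** Obtained by squaring 1 + |z| / 4 <= exp (|z| / 4). *)
Lemma sqr_le_expR z : z ^+ 2 <= 16 * expR (`|z| / 2).
Proof.
have := expR_ge1Dx (`|z| / 4); rewrite -real_normK ?num_real//.
have -> : `|z| / 2 = `|z| / 4 + `|z| / 4 by field.
by rewrite expRD; have := normr_ge0 z; set e := expR _; nra.
Qed.

(** Since |l| <= 1/2, the remainder at l z costs only exp (|z| / 2); the other half of exp |z|
    absorbs the factor z^2, so the error stays of order l^2. *)
Lemma expR_scaled_le l z : `|l| <= 1 / 2 ->
  expR (l * z) <= 1 + l * z + 16 * l ^+ 2 * expR `|z|.
Proof.
move=> l2; apply: (le_trans (expR_le_quadratic _)).
rewrite lerD2l exprMn.
have le1 : expR `|l * z| <= expR (`|z| / 2).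
  rewrite ler_expR normrM mulrC ler_pM//; lra.
have -> : expR `|z| = expR (`|z| / 2) * expR (`|z| / 2).
  by rewrite -expRD; congr expR; field.
have : z ^+ 2 * expR `|l * z| <= 16 * expR (`|z| / 2) * expR (`|z| / 2).
  by rewrite ler_pM ?sqr_ge0 ?expR_ge0// sqr_le_expR.
by have := sqr_ge0 l; nra.
Qed.

Lemma expR_half_le2 : expR (1 / 2) <= 2 :> R.
Proof.
have := expR_ge1Dx (- (1 / 2) : R); have := expRxMexpNx_1 (1 / 2 : R).
have := expR_gt0 (1 / 2 : R).
by set e := expR (1 / 2); set e' := expR _; nra.
Qed.

(** The ratios a / (a + b) and b / (a + b) lie in [0, 1], so their p-th powers do not exceed them,
    and they add up to 1. *)
Lemma powRD_superadditive p a b : 1 <= p -> 0 <= a -> 0 <= b ->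
  a `^ p + b `^ p <= (a + b) `^ p.
Proof.
move=> p1 a0 b0; have p0 : p != 0 by lra.
have [s0|s0] := eqVneq (a + b) 0.
  have [-> ->] : a = 0 /\ b = 0 by split; lra.
  by rewrite addr0 powR0// addr0.
have {s0}s0 : 0 < a + b by rewrite lt_def s0 addr_ge0.
have part (c : R) : 0 <= c -> c <= a + b ->
    c `^ p <= c / (a + b) * (a + b) `^ p.
  move=> c0 cs; rewrite -{1}(divfK (lt0r_neq0 s0) c) powRM ?divr_ge0 ?(ltW s0)//.
  rewrite ler_pM2r ?powR_gt0//.
  have [->|cn0] := eqVneq c 0; first by rewrite mul0r powR0.
  have {cn0}c0' : 0 < c by rewrite lt_def cn0.
  by rewrite ge1r_powR// divr_gt0//= ler_pdivrMr// mul1r.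
apply: (le_trans (lerD (part a a0 _) (part b b0 _))); [lra|lra|].
by rewrite -mulrDl -mulrDl divff ?mul1r// lt0r_neq0.
Qed.

(** For b <= a this is superadditivity applied to a = (a - b) + b. *)
Lemma powR_dist_le p a b : 1 <= p -> 0 <= a -> 0 <= b ->
  `|a - b| `^ p <= `|a `^ p - b `^ p|.
Proof.
move=> p1; wlog ba : a b / b <= a => [hw|a0 b0].
  have [/hw//|/ltW ab a0 b0] := leP b a.
  by rewrite distrC (distrC (a `^ p)) hw.
have := powRD_superadditive p (a - b) b p1.
rewrite subrK subr_ge0 => /(_ ba b0).
rewrite ger0_norm ?subr_ge0// => ?.
by rewrite ger0_norm; have := powR_ge0 (a - b) p; lra.
Qed.

End RealInequalities.

(** * Independence and expectations of products *)

Section IndependentExpectation.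
Context {d : measure_display} {T : measurableType d} {R : realType}.

Import HBNNSimple.

(** The usual extension: indicators to simple functions by linearity, then to nonnegative measurable
    [f] by monotone convergence. Finiteness of [c] makes multiplication by [c] pass to the limit. *)
Lemma integral_factor_of_indic {d' : measure_display} {U : measurableType d'}
    (mu : {measure set T -> \bar R}) (phi : T -> U)
    (g : T -> R) (c : \bar R) :
  measurable_fun setT phi -> measurable_fun setT g ->
  (forall w, 0 <= g w) -> c \is a fin_num ->
  (forall B, measurable B ->
    (\int[mu]_w (g w * \1_B (phi w))%:E = c * mu (phi @^-1` B))%E) ->
  forall f : U -> R, measurable_fun setT f -> (forall x, 0 <= f x) ->
    (\int[mu]_w (g w * f (phi w))%:E = c * \int[mu]_w (f (phi w))%:E)%E.
Proof.
move=> mphi mg g0 cfin factor f mf f0.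
have mEf : measurable_fun setT (EFin \o f) by exact/measurable_EFinP.
have f0E x : setT x -> (0 <= (EFin \o f) x)%E by move=> _; rewrite lee_fin.
pose h := nnsfun_approx measurableT mEf.
have mh k : measurable_fun setT (h k \o phi).
  by apply: measurableT_comp => //; exact: measurable_funP.
have hcvg w : (h k (phi w))%:E @[k --> \oo] --> (f (phi w))%:E.
  exact: (cvg_nnsfun_approx measurableT mEf f0E I).
have hmono w : {homo (fun k => h k (phi w)) : m n / (m <= n)%N >-> m <= n}.
  by move=> m n mn; exact/lefP/nd_nnsfun_approx.
have simple k : (\int[mu]_w (g w * h k (phi w))%:E =
    c * \int[mu]_w (h k (phi w))%:E)%E.
  have mpre r : measurable (phi @^-1` (h k @^-1` [set r])).
    by rewrite -(setTI (_ @^-1` _)); exact: mphi.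
  have m1 r : measurable_fun setT (fun w => \1_(h k @^-1` [set r]) (phi w) : R).
    by apply: measurableT_comp => //; exact: measurable_indic.
  (* For r < 0 the level set is empty, as [h k] is nonnegative, and the product is 0. *)
  have r0 r w : 0 <= r * \1_(h k @^-1` [set r]) (phi w).
    by rewrite -lee_fin EFinM nnfun_muleindic_ge0.
  have decomp w : h k (phi w) =
      \sum_(r \in range (h k)) r * \1_(h k @^-1` [set r]) (phi w).
    exact: fimfunE.
  have finr : finite_set (range (h k)) by [].
  under eq_integral.
    move=> w _; rewrite decomp EFinM -fsumEFin// ge0_mule_fsumr; last first.
      by move=> r; rewrite lee_fin.
    over.
  rewrite ge0_integral_fsum//; last 2 first.
  - move=> r; apply: emeasurable_funM; first exact/measurable_EFinP.
    exact/measurable_EFinP/measurable_funM.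
  - by move=> r w _; rewrite mule_ge0 ?lee_fin.
  under [in RHS]eq_integral do rewrite decomp -fsumEFin//.
  rewrite ge0_integral_fsum//; last 2 first.
  - by move=> r; exact/measurable_EFinP/measurable_funM.
  - by move=> r w _; rewrite lee_fin.
  rewrite ge0_mule_fsumr => [|r]; last first.
    by apply: integral_ge0 => w _; rewrite lee_fin.
  (* The sums are compared termwise: [r] is a value of [h k], hence nonnegative, and comes out of
     both integrals. *)
  apply: eq_fsbigr => r /set_mem[x _ hr].
  have {x hr}r_ge0 : 0 <= r by rewrite -hr.
  under eq_integral do rewrite -EFinM mulrCA EFinM.
  under [in RHS]eq_integral do rewrite EFinM.
  rewrite !ge0_integralZl_EFin//; last 3 first.
  - exact/measurable_EFinP.
  - by move=> w _; rewrite lee_fin mulr_ge0.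
  - exact/measurable_EFinP/measurable_funM.
  rewrite factor; last first.
    by rewrite -(setTI (_ @^-1` _)); exact: (measurable_funP (h k)).
  rewrite (_ : (fun w => (\1_(h k @^-1` [set r]) (phi w))%:E) =
    EFin \o \1_(phi @^-1` (h k @^-1` [set r]))); last exact/funext.
  by rewrite integral_indic// setIT muleCA.
(* Monotone convergence for a general sequence, so that it serves both with the weight [g] and
   without it. *)
have mcvg (u : (T -> R)^nat) (v : T -> R) :
    (forall k, measurable_fun setT (u k)) -> (forall k w, 0 <= u k w) ->
    (forall w, {homo (fun k => u k w) : m n / (m <= n)%N >-> m <= n}) ->
    (forall w, (u k w)%:E @[k --> \oo] --> (v w)%:E) ->
  (\int[mu]_w (u k w)%:E @[k --> \oo] --> \int[mu]_w (v w)%:E)%E.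
  move=> mu_ u0 und uv.
  rewrite [X in _ --> X](_ : _ = \int[mu]_w limn (fun k => (u k w)%:E))%E.
    apply: cvg_monotone_convergence => //.
    - by move=> k; exact/measurable_EFinP.
    - by move=> k w _; rewrite lee_fin.
    - by move=> w _ m n mn; rewrite lee_fin und.
  by apply: eq_integral => w _; apply/esym/cvg_lim.
have cvg_g : (\int[mu]_w (g w * h k (phi w))%:E @[k --> \oo] -->
    \int[mu]_w (g w * f (phi w))%:E)%E.
  apply: mcvg => [k|k w|w m n mn|w].
  - exact: (measurable_funM mg (mh k)).
  - by rewrite mulr_ge0.
  - by rewrite ler_wpM2l// hmono.
  - exact: (cvgeZl (y := (g w)%:E) _ (hcvg w)).
have cvg_1 : (\int[mu]_w (h k (phi w))%:E @[k --> \oo] -->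
    \int[mu]_w (f (phi w))%:E)%E.
  by apply: mcvg => // k w.
apply: (cvg_unique _ cvg_g) => //.
by rewrite (_ : (fun k => _) = (fun k => c * \int[mu]_w (h k (phi w))%:E)%E);
  [exact: cvgeZl|exact/funext].
Qed.

Lemma expectation_prod_independent (P : probability T R) (n : nat)
    (X : 'I_n -> {RV P >-> R}) (f : 'I_n -> R -> R) :
  mutually_independent X ->
  (forall i, measurable_fun setT (f i)) -> (forall i x, 0 <= f i x) ->
  (forall i, \int[P]_w (f i (X i w))%:E < +oo)%E ->
  (\int[P]_w (\prod_(i < n) f i (X i w))%:E =
   \prod_(i < n) \int[P]_w (f i (X i w))%:E)%E.
Proof.
move=> indep.
(* One coordinate at a time: [f i] is arbitrary for [i < k] and an indicator
   for [i >= k]; the product rule for events is the case [k = 0]. *)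
suff : forall k (f : 'I_n -> R -> R),
    (forall i : 'I_n, (k <= i)%N ->
      exists2 B : set R, measurable B & f i = \1_B) ->
    (forall i, measurable_fun setT (f i)) -> (forall i x, 0 <= f i x) ->
    (forall i, \int[P]_w (f i (X i w))%:E < +oo)%E ->
    (\int[P]_w (\prod_(i < n) f i (X i w))%:E =
     \prod_(i < n) \int[P]_w (f i (X i w))%:E)%E.
  by move=> /(_ n f); apply => i; rewrite leqNgt ltn_ord.
elim=> [|k IH] {}f find mf f0 foo.
  have {}find i := find i isT.
  pose B i := s2val (cid2 (find i)).
  have mB i : measurable (B i) := s2valP (cid2 (find i)).
  have fB i : f i = \1_(B i) := s2valP' (cid2 (find i)).
  have mXB i : measurable (X i @^-1` B i).
    by rewrite -(setTI (_ @^-1` _)); exact: (measurable_funP (X i)).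
  have := indep [set: 'I_n]%SET B mB.
  under [X in _ = X -> _]eq_bigl do rewrite inE.
  move=> indepB.
  transitivity (\prod_(i < n) P (X i @^-1` B i))%E; last first.
    apply: eq_bigr => i _; rewrite fB.
    rewrite (_ : (fun w => _) = EFin \o \1_(X i @^-1` B i)); last exact/funext.
    by rewrite integral_indic// setIT.
  rewrite -indepB.
  have mI : measurable [set w | forall i, i \in [set: 'I_n]%SET -> B i (X i w)].
    rewrite (_ : mkset _ = \bigcap_(i in [set: 'I_n]) (X i @^-1` B i)).
      exact: fin_bigcap_measurable.
    by apply/seteqP; split => w /= inB i => [_|_]; apply: inB; rewrite ?inE.
  (* A product of indicators is the indicator of the intersection: it is 1 if every [B i] is hit,
     and one missed [B i] makes it 0. *)
  rewrite -[X in P X]setIT -integral_indic//; apply: eq_integral => w _.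
  congr EFin; rewrite indicE; case: (boolP (w \in _)) => [/set_mem/= inB|/negP notinB].
    rewrite big1// => i _; rewrite fB indicE mem_set//.
    by apply: inB; rewrite inE.
  have /existsNP[i] : ~ forall i, B i (X i w).
    by move=> inB; apply: notinB; apply/mem_set => i _ /=; exact: inB.
  by move=> Bi; rewrite (bigD1 i)//= fB indicE memNset ?mul0r.
(* If n <= k, no index is at least k, and the induction hypothesis applies to [f] itself. *)
have [kn|nk] := ltnP k n; last first.
  apply: IH => // i ki.
  by have := leq_trans (leq_trans (ltn_ord i) nk) ki; rewrite ltnn.
pose k' := Ordinal kn.
rewrite [RHS](bigD1 k')//= muleC.
under eq_integral do rewrite (bigD1 k')//= mulrC.
(* The factors other than [k'] form the weight, which reduces the claim to an indicator in
   coordinate [k']. *)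
apply: (@integral_factor_of_indic _ _ P (X k')
  (fun w => \prod_(i < n | i != k') f i (X i w))) => //.
- under eq_fun do rewrite -big_filter.
  apply: measurable_prod => i _; apply: (measurableT_comp (mf i)).
  exact: measurable_funP.
- by move=> w; apply: prodr_ge0.
- apply: prode_fin_num => i _; rewrite ge0_fin_numE//.
  by apply: integral_ge0 => w _; rewrite lee_fin.
move=> B mB.
(* Replacing coordinate [k'] by the indicator of [B] brings the family under the induction
   hypothesis. *)
pose f' i := if i == k' then \1_B else f i.
have f'D i : i != k' -> f' i = f i by rewrite /f' => /negbTE->.
have f'k : f' k' = \1_B by rewrite /f' eqxx.
have mXB : measurable (X k' @^-1` B).
  by rewrite -(setTI (_ @^-1` _)); exact: (measurable_funP (X k')).
have intB : (\int[P]_w (\1_B (X k' w))%:E = P (X k' @^-1` B))%E.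
  rewrite (_ : (fun w => _) = EFin \o \1_(X k' @^-1` B)); last exact/funext.
  by rewrite integral_indic// setIT.
have /IH : forall i : 'I_n, (k <= i)%N ->
    exists2 B : set R, measurable B & f' i = \1_B.
  move=> i ki; have [->|ik] := eqVneq i k'; first by exists B.
  rewrite f'D//; apply: find; rewrite ltn_neqAle ki andbT.
  by apply: contra_neq ik => ik; apply: val_inj; rewrite /= -ik.
have mf' i : measurable_fun setT (f' i).
  have [->|ik] := eqVneq i k'; last by rewrite f'D.
  by rewrite f'k; exact: measurable_indic.
have f'0 i x : 0 <= f' i x.
  have [->|ik] := eqVneq i k'; last by rewrite f'D.
  by rewrite f'k indicE.
have f'oo i : (\int[P]_w (f' i (X i w))%:E < +oo)%E.
  have [->|ik] := eqVneq i k'; last by rewrite f'D.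
  by rewrite f'k intB (le_lt_trans (probability_le1 _ mXB)) ?ltry.
move=> /(_ mf' f'0 f'oo); rewrite [RHS](bigD1 k')//= f'k intB muleC.
move=> IHf; rewrite [LHS](_ : _ = \int[P]_w (\prod_i f' i (X i w))%:E)%E.
  rewrite IHf; congr (_ * _)%E.
  by apply: eq_bigr => i ik; rewrite f'D.
apply: eq_integral => w _; rewrite [in RHS](bigD1 k')//= f'k mulrC.
by congr (_ * _)%:E; apply: eq_bigr => i ik; rewrite f'D.
Qed.

End IndependentExpectation.

(** * Exponential moments of a single variable *)

Section ExponentialMoments.
Context {d : measure_display} {T : measurableType d} {R : realType}.
Variable P : probability T R.

(** As 0 <= Y <= exp Y, integrability of exp Y carries over to Y. *)
Lemma integrable_exp_moment (Y : T -> R) :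
  measurable_fun setT Y -> (forall w, 0 <= Y w) ->
  (\int[P]_w (expR (Y w))%:E <= 2%:E)%E ->
  P.-integrable setT (fun w => (expR (Y w))%:E) /\
  P.-integrable setT (EFin \o Y).
Proof.
move=> mY Y0 expY.
have mexpY : measurable_fun setT (fun w => (expR (Y w))%:E).
  by apply/measurable_EFinP; apply: measurableT_comp.
have iexpY : P.-integrable setT (fun w => (expR (Y w))%:E).
  apply/integrableP; split => //.
  under eq_integral do rewrite gee0_abs ?lee_fin ?expR_ge0//.
  by rewrite (le_lt_trans expY) ?ltry.
split=> //; apply: le_integrable iexpY => //; first exact/measurable_EFinP.
move=> w _; rewrite /= lee_fin !ger0_norm ?expR_ge0//.
by have := expR_ge1Dx (Y w); lra.
Qed.

(** On integrating [expR_scaled_le] at z = Y - m the linear term vanishes. As 0 <= m <= 1, |Y - m|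
    <= Y + 1, so the quadratic term is at most 16 l^2 * e * 2, and 1 + x <= exp x concludes. *)
Lemma centered_mgf_le (Y : T -> R) (l : R) :
  measurable_fun setT Y -> (forall w, 0 <= Y w) ->
  (\int[P]_w (expR (Y w))%:E <= 2%:E)%E -> `|l| <= 1 / 2 ->
  (\int[P]_w (expR (l * (Y w - fine (\int[P]_w (Y w)%:E))))%:E <=
    (expR (32 * expR 1 * l ^+ 2))%:E)%E.
Proof.
move=> mY Y0 expY l2; have [iexpY iY] := integrable_exp_moment _ mY Y0 expY.
have iYfin := integrable_fin_num measurableT iY.
set m := fine _.
have EY : (\int[P]_w (Y w)%:E = m%:E)%E by rewrite fineK.
have icst (r : R) : P.-integrable setT (fun=> r%:E).
  exact: finite_measure_integrable_cst.
have Ecst (r : R) : (\int[P]_w r%:E = r%:E)%E.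
  rewrite integral_cst// -[RHS]mule1; congr (_ * _)%E.
  exact: (probability_setT P).
have m0 : 0 <= m.
  by rewrite -lee_fin -EY; apply: integral_ge0 => w _; rewrite lee_fin.
(* Integrating 1 + Y <= exp Y gives 1 + m <= 2. *)
have m1 : m <= 1.
  have : (m%:E + 1 <= \int[P]_w (expR (Y w))%:E)%E.
    rewrite -EY -[X in (_ + X)%E]Ecst -integralD//.
    apply: ge0_le_integral => //.
    - by move=> w _; rewrite -EFinD lee_fin addr_ge0.
    - exact/emeasurable_funD/measurable_cst/measurable_EFinP.
    - exact: measurable_int iexpY.
    - by move=> w _; rewrite -EFinD lee_fin addrC expR_ge1Dx.
  by move=> /le_trans/(_ expY); rewrite -EFinD lee_fin; lra.
pose a := 1 - l * m; pose b := 16 * l ^+ 2 * expR 1.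
have b0 : 0 <= b.
  by rewrite /b; have := sqr_ge0 l; have := expR_ge0 (1 : R); nra.
have pointwise w :
    expR (l * (Y w - m)) <= a + l * Y w + b * expR (Y w).
  have -> : a + l * Y w = 1 + l * (Y w - m) by rewrite /a; ring.
  apply: (le_trans (expR_scaled_le _ (Y w - m) l2)); rewrite lerD2l /b.
  rewrite -(mulrA (16 * _)) -expRD.
  rewrite ler_wpM2l ?(mulr_ge0 _ (sqr_ge0 l))// ler_expR.
  by rewrite ler_norml; have := Y0 w; lra.
have ilY : P.-integrable setT (fun w => l%:E * (Y w)%:E)%E.
  exact: integrableZl.
have ialY : P.-integrable setT (fun w => a%:E + l%:E * (Y w)%:E)%E.
  exact: integrableD.
have ibexpY : P.-integrable setT (fun w => b%:E * (expR (Y w))%:E)%E.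
  exact: integrableZl.
have iaff := integrableD measurableT ialY ibexpY.
apply: (@le_trans _ _
    (\int[P]_w (a%:E + l%:E * (Y w)%:E + b%:E * (expR (Y w))%:E))%E).
  apply: le_integral => //.
  - apply: (@le_integrable _ _ _ P _ measurableT _ _ _ _ iaff) => //.
      apply/measurable_EFinP; apply: measurableT_comp => //.
      by apply: measurable_funM => //; exact: measurable_funB.
    move=> w _; rewrite -!EFinM -!EFinD /= lee_fin.
    rewrite ger0_norm ?expR_ge0// (le_trans (pointwise w))//.
    exact: ler_norm.
  - by move=> w _; rewrite -!EFinM -!EFinD lee_fin.
rewrite !integralD//.
rewrite !integralZl// Ecst EY.
apply: (@le_trans _ _ (1 + 2 * b)%:E); last first.
  by rewrite lee_fin; apply: le_trans (expR_ge1Dx _); rewrite /b; lra.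
rewrite (_ : (1 + 2 * b)%:E = (a%:E + l%:E * m%:E + b%:E * 2%:E)%E).
  by rewrite leeD2l// lee_wpmul2l// lee_fin.
by rewrite -!EFinM -!EFinD /a; congr EFin; ring.
Qed.

(** Halving the exponent keeps the bound at 2, the threshold in [psi_norm]: 1 + (2 + 2) / 4 = 2,
    whereas adding the two signs directly would give 4. *)
Lemma exp_half_norm_le2 (S : T -> R) : measurable_fun setT S ->
  (\int[P]_w (expR (S w))%:E <= 2%:E)%E ->
  (\int[P]_w (expR (- S w))%:E <= 2%:E)%E ->
  (\int[P]_w (expR (`|S w| / 2))%:E <= 2%:E)%E.
Proof.
move=> mS Sp Sn.
have mEp : measurable_fun setT (fun w => (expR (S w))%:E).
  by apply/measurable_EFinP; exact: measurableT_comp.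
have mEn : measurable_fun setT (fun w => (expR (- S w))%:E).
  apply/measurable_EFinP; apply: measurableT_comp => //.
  exact: measurableT_comp.
(* AM-GM: [exp (|s| / 2) <= 1 + exp |s| / 4]. *)
apply: (@le_trans _ _ (\int[P]_w
    (1%:E + (4^-1)%:E * ((expR (S w))%:E + (expR (- S w))%:E)))%E).
  apply: ge0_le_integral => //.
  - apply/measurable_EFinP; apply: measurableT_comp => //.
    by apply: measurable_funM => //; exact: measurableT_comp.
  - apply: emeasurable_funD; first exact: measurable_cst.
    by apply: measurable_funeM; exact: emeasurable_funD.
  move=> w _; rewrite -(EFinD (expR _)) -(EFinM 4^-1) -(EFinD 1) lee_fin.
  have : expR `|S w| <= expR (S w) + expR (- S w).
    have [S0|S0] := leP 0 (S w).
      by rewrite ger0_norm// lerDl expR_ge0.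
    by rewrite ltr0_norm// lerDr expR_ge0.
  have -> : `|S w| = `|S w| / 2 + `|S w| / 2 by field.
  rewrite expRD (_ : (`|S w| / 2 + `|S w| / 2) / 2 = `|S w| / 2); last by field.
  by have := sqr_ge0 (expR (`|S w| / 2) - 2); set u := expR (`|S w| / 2); nra.
have m2 := emeasurable_funD mEp mEn.
rewrite ge0_integralD//; last 2 first.
- by move=> w _; rewrite mule_ge0// lee_fin.
- exact: measurable_funeM.
rewrite ge0_integralZl_EFin//; last by move=> w _; rewrite adde_ge0.
rewrite ge0_integralD// integral_cst//.
rewrite (_ : 1 * _ = 1)%E; last by rewrite mul1e; exact: (probability_setT P).
apply: (@le_trans _ _ (1%:E + 4^-1%:E * (2%:E + 2%:E))%E).
  by rewrite leeD2l// lee_wpmul2l ?leeD// lee_fin.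
by rewrite -(EFinD 2) -(EFinM 4^-1) -(EFinD 1) lee_fin; lra.
Qed.

End ExponentialMoments.

(** The exponential of the sum is a product of functions of single coordinates; independence factors
    its expectation, and the n equal bounds multiply. *)
Lemma sum_centered_mgf_le {d : measure_display} {T : measurableType d}
    {R : realType} (P : probability T R) (n : nat) (X : 'I_n -> {RV P >-> R})
    (f : R -> R) (l : R) :
  mutually_independent X ->
  measurable_fun setT f -> (forall x, 0 <= f x) ->
  (forall i, \int[P]_w (expR (f (X i w)))%:E <= 2%:E)%E -> `|l| <= 1 / 2 ->
  (\int[P]_w (expR (l * \sum_(i < n)
      (f (X i w) - fine (\int[P]_w (f (X i w))%:E))))%:E <=
    (expR (32 * expR 1 * l ^+ 2 * n%:R))%:E)%E.
Proof.
move=> indep mf f0 expf l2.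
pose m i := fine (\int[P]_w (f (X i w))%:E)%E.
pose g i x := expR (l * (f x - m i)).
have mfX i : measurable_fun setT (f \o X i).
  by apply: measurableT_comp => //; exact: measurable_funP.
have gle i : (\int[P]_w (g i (X i w))%:E <= (expR (32 * expR 1 * l ^+ 2))%:E)%E.
  exact: (centered_mgf_le P (f \o X i) l (mfX i) (fun w => f0 _) (expf i) l2).
rewrite [leLHS](_ : _ = \prod_(i < n) \int[P]_w (g i (X i w))%:E)%E; last first.
  rewrite -(expectation_prod_independent P n X g)//.
  - by apply: eq_integral => w _; rewrite mulr_sumr expR_sum.
  - move=> i; apply: measurableT_comp => //.
    by apply: measurable_funM => //; exact: measurable_funB.
  - by move=> i x; exact: expR_ge0.
  - by move=> i; rewrite (le_lt_trans (gle i)) ?ltry.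
apply: (@le_trans _ _ (\prod_(i < n) (expR (32 * expR 1 * l ^+ 2))%:E)%E).
  (* Nonnegativity is carried through the induction because multiplying the inequalities requires
     it. *)
  suff /andP[] : (0 <= \prod_(i < n) \int[P]_w (g i (X i w))%:E <=
      \prod_(i < n) (expR (32 * expR 1 * l ^+ 2))%:E)%E by [].
  elim/big_ind2 : _ => [|x1 x2 y1 y2 /andP[x10 x12] /andP[y10 y12]|i _].
  - by rewrite lexx lee01.
  - by rewrite mule_ge0// lee_pmul.
  - by rewrite gle integral_ge0// => w _; rewrite lee_fin expR_ge0.
by rewrite prodEFin prodr_const card_ord -expRM_natr.
Qed.

Lemma measurable_powR_normr_div {R : realType} (p K : R) :
  measurable_fun setT (fun x : R => `|x / K| `^ p).
Proof.
apply: (measurableT_comp (measurable_powR p)); apply: measurableT_comp => //.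
exact: measurable_funM.
Qed.

(** * Concentration of the p-norm at a fixed scale [K] *)

Section NormConcentration.
Context {d : measure_display} {T : measurableType d} {R : realType}.
Variables (P : probability T R) (n : nat) (X : 'I_n -> {RV P >-> R}) (p K : R).
Hypotheses (p1 : 1 <= p) (K0 : 0 < K).

Let f (x : R) := `|x / K| `^ p.
Let normX w := lp_norm p (fun i => X i w).

Let p0 : p != 0. Proof. by rewrite gt_eqF// (lt_le_trans ltr01). Qed.

Let f_ge0 x : 0 <= f x. Proof. exact: powR_ge0. Qed.

Let measurable_f : measurable_fun setT f.
Proof. exact: measurable_powR_normr_div. Qed.

Let measurable_fX i : measurable_fun setT (fun w => f (X i w)).
Proof. by apply: (measurableT_comp measurable_f); exact: measurable_funP. Qed.

Let measurable_normX : measurable_fun setT normX.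
Proof.
apply: (measurableT_comp (measurable_powR p^-1)).
apply: measurable_sum => i; apply: (measurableT_comp (measurable_powR p)).
by apply: measurableT_comp => //; exact: measurable_funP.
Qed.

Let normX_powR w : normX w `^ p = K `^ p * \sum_(i < n) f (X i w).
Proof.
rewrite /normX /lp_norm -powRrM mulVf// powRr1; last first.
  by apply: sumr_ge0 => i _; exact: powR_ge0.
rewrite mulr_sumr; apply: eq_bigr => i _.
rewrite /f -powRM// ?(ltW K0)// normrM normfV (gtr0_norm K0) mulrC.
by rewrite divfK ?gt_eqF.
Qed.

Hypothesis exp_moment : forall i, (\int[P]_w (expR (f (X i w)))%:E <= 2%:E)%E.

Let mean i := fine (\int[P]_w (f (X i w))%:E).
Let m := fine ('N[P]_(p%:E)[EFin \o normX])%E.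

(** The p-th power undoes the outer root and leaves the expectation of the p-th power of [normX],
    which is linear in the f (X_i). By [exp_moment] all means are finite, so [fine] discards
    nothing. *)
Let Lnorm_powR : m `^ p = K `^ p * \sum_(i < n) mean i.
Proof.
have EfX i : (\int[P]_w (f (X i w))%:E = (mean i)%:E)%E.
  have [_ iY] := integrable_exp_moment P _ (measurable_fX i) (fun=> f_ge0 _)
    (exp_moment i).
  by rewrite fineK// integrable_fin_num.
rewrite /m -fine_poweR poweR_Lnorm//.
rewrite (_ : (fun w => _) =
    (fun w => (K `^ p)%:E * \sum_(i < n) (f (X i w))%:E)%E).
  rewrite ge0_integralZl_EFin//; last 3 first.
  - by move=> w _; apply: sume_ge0 => i _; rewrite lee_fin.
  - by apply: emeasurable_sum => i; exact/measurable_EFinP.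
  - exact: powR_ge0.
  rewrite ge0_integral_sum//; last 2 first.
  - by move=> i; exact/measurable_EFinP.
  - by move=> i w _; rewrite lee_fin.
  by under eq_bigr do rewrite EfX; rewrite sumEFin.
apply/funext => w.
by rewrite sumEFin -EFinM -normX_powR /= ger0_norm// powR_ge0.
Qed.

Lemma psi_norm_lp_norm_le :
  mutually_independent X -> (0 < n)%N ->
  (psi_norm P p (fun w => (normX w - m)%R) <=
    ((2 * (8 * expR (1 / 2)) * Num.sqrt n%:R) `^ p^-1 * K)%:E)%E.
Proof.
move=> indep n0.
set C : R := 8 * expR (1 / 2); set s : R := Num.sqrt n%:R.
have s1 : 1 <= s by rewrite -sqrtr1 ler_sqrt ?ler1n ?ltr0n.
have s2 : s ^+ 2 = n%:R by rewrite sqr_sqrtr.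
have C8 : 8 <= C.
  by rewrite /C; have := expR_ge1Dx (1 / 2 : R); lra.
have C2 : C ^+ 2 = 64 * expR 1.
  rewrite (_ : expR 1 = expR (1 / 2) * expR (1 / 2)); first by rewrite /C; ring.
  by rewrite -expRD; congr expR; field.
(* With C^2 = 64 e and s^2 = n, this choice makes 32 e l^2 n equal to 1/2, and exp (1/2) <= 2. The
   bounds C >= 8 and s >= 1 ensure l <= 1/2. *)
pose l := (C * s)^-1.
have l0 : 0 < l by rewrite invr_gt0; nra.
have l2 : l <= 1 / 2.
  by rewrite /l -[leRHS]invrK lef_pV2 ?posrE; nra.
have lsq : 32 * expR 1 * l ^+ 2 * n%:R = 1 / 2.
  rewrite -s2 /l exprVn exprMn C2 ; field.
  by rewrite !lt0r_neq0 ?expR_gt0//; lra.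
pose S w := l * \sum_(i < n) (f (X i w) - mean i).
have mS : measurable_fun setT S.
  apply: measurable_funM => //; apply: measurable_sum => i.
  exact: measurable_funB.
have expS (t : R) : `|t| = l ->
    (\int[P]_w (expR (t * \sum_(i < n) (f (X i w) - mean i)))%:E <= 2%:E)%E.
  move=> tl.
  have := sum_centered_mgf_le P n X f t indep measurable_f f_ge0 exp_moment.
  rewrite tl => /(_ l2) /le_trans; apply; rewrite lee_fin.
  by rewrite -real_normK ?num_real// tl lsq expR_half_le2.
have := exp_half_norm_le2 P S mS.
move=> /(_ (expS l (gtr0_norm l0))).
under eq_integral do rewrite /S -mulNr.
move=> /(_ (expS (- l) _)); rewrite normrN => /(_ (gtr0_norm l0)) expS2.
have Cs0 : 0 < 2 * C * s by nra.
(* Here q^p = 2 / l, which matches the exponent |S| / 2; the scale q K is then admissible in the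
   infimum. *)
set q := (2 * C * s) `^ p^-1.
have q0 : 0 < q by rewrite powR_gt0.
have qp : q `^ p = 2 * C * s by rewrite -powRrM mulVf// powRr1 ?(ltW Cs0).
apply: ereal_inf_lbound; exists (q * K) => //; split; first exact: mulr_gt0.
rewrite unlock; apply: le_trans expS2.
apply: ge0_le_integral => //.
- apply/measurable_EFinP; apply: measurableT_comp => //.
  apply: (measurableT_comp (measurable_powR p)); apply: measurableT_comp => //.
  by apply: measurable_funM => //; exact: measurable_funB.
- apply/measurable_EFinP; apply: measurableT_comp => //.
  by apply: measurable_funM => //; exact: measurableT_comp.
move=> w _; rewrite lee_fin ler_expR.
have m0 : 0 <= m by rewrite fine_ge0// Lnorm_ge0.
have normX0 : 0 <= normX w by exact: powR_ge0.
have qK0 : 0 < q * K by exact: mulr_gt0.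
have Kp0 : 0 < K `^ p by rewrite powR_gt0.
rewrite -(ler_pM2r (powR_gt0 p qK0)) -powRM ?(ltW qK0)//.
rewrite normrM normfV (gtr0_norm qK0) divfK ?gt_eqF//.
rewrite (powRM _ (ltW q0) (ltW K0)) qp.
apply: (le_trans (powR_dist_le _ _ _ p1 normX0 m0)).
rewrite normX_powR Lnorm_powR -mulrBr -sumrB normrM (gtr0_norm Kp0).
(* Both sides now equal K^p times the absolute value of the centered sum, because 2 C s l / 2 =
   1. *)
rewrite /S normrM (gtr0_norm l0) le_eqVlt; apply/orP; left; apply/eqP.
rewrite /l; field.
by rewrite !gt_eqF//; lra.
Qed.

End NormConcentration.

(** * From a fixed scale to the maximal norm *)

Theorem proposition1p3 (R : realType) :
  exists C : R, 0 < C /\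
    forall (p : R) (n : nat) (d : measure_display) (T : measurableType d)
      (P : probability T R) (X : 'I_n -> {RV P >-> R}),
      1 <= p -> (0 < n)%N ->
      mutually_independent X ->
      (forall i, sub_exponential P p (X i)) ->
      let normX := fun w : T => lp_norm p (fun i => X i w) in
      let m := fine ('N[P]_(p%:E)[EFin \o normX])%E in
      let Kp := (\big[maxe/-oo]_(i < n) psi_norm P p (X i))%E in
      (psi_norm P p (fun w => (normX w - m)%R) <=
        ((2 * C * Num.sqrt n%:R) `^ p^-1)%:E * Kp)%E.
Proof.
exists (8 * expR (1 / 2)); split; first by rewrite mulr_gt0// expR_gt0.
move=> p n d T P X p1 n0 indep _; lazy zeta.
set m := fine _; set Kp := bigop _ _ _; set c := _ `^ _.
pose normX w := lp_norm p (fun i => X i w).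
have c0 : 0 < c.
  by rewrite powR_gt0// !mulr_gt0 ?expR_gt0 ?sqrtr_gt0 ?ltr0n.
have psi_ge0 i : (0 <= psi_norm P p (X i))%E.
  by apply: le_ereal_inf_tmp => _ [K [K0 _] <-]; rewrite lee_fin ltW.
have le_Kp i : (psi_norm P p (X i) <= Kp)%E by exact: le_bigmax.
(* The maximum starts from -oo; a coordinate, available as n > 0, makes it nonnegative. *)
have Kp0 : (0 <= Kp)%E := le_trans (psi_ge0 (Ordinal n0)) (le_Kp _).
(* Each infimum lies below K, so some admissible k < K exists; enlarging k to K only lowers the
   exponential moment, so K is admissible for every coordinate. *)
have bound (K : R) : (Kp < K%:E)%E ->
    (psi_norm P p (fun w => (normX w - m)%R) <= (c * K)%:E)%E.
  move=> KpK; have K0 : 0 < K by rewrite -lte_fin (le_lt_trans Kp0).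
  apply: psi_norm_lp_norm_le => // i.
  have /ereal_inf_lt[_ [k [k0 Ek] <-] kK] := le_lt_trans (le_Kp i) KpK.
  move: Ek; rewrite unlock; apply: le_trans; apply: ge0_le_integral => //.
  - apply/measurable_EFinP/measurableT_comp => //.
    exact: (measurableT_comp (measurable_powR_normr_div p K)).
  - apply/measurable_EFinP/measurableT_comp => //.
    exact: (measurableT_comp (measurable_powR_normr_div p k)).
  move=> w _; rewrite lee_fin ler_expR ge0_ler_powR ?nnegrE//; first lra.
  rewrite !normrM ler_wpM2l// !normfV lef_pV2 ?posrE ?normr_gt0 ?gt_eqF//.
  by rewrite !gtr0_norm// ltW.
(* For finite [Kp], K decreases to it, the excess e / c costing e after multiplication by c. For
   infinite [Kp] the right side is +oo because c > 0. *)
case: Kp Kp0 bound {le_Kp} => [k| |]// k0 bound.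
- apply/lee_addgt0Pr => e e0.
  rewrite -EFinM -EFinD (_ : c * k + e = c * (k + e / c)).
    by apply: bound; rewrite lte_fin ltrDl divr_gt0.
  by rewrite mulrDr mulrCA divff ?mulr1// gt_eqF.
- by rewrite gt0_muley ?lte_fin// leey.
Qed.
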